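(* Let $r\ge 1$ be an integer and let $T$ be a (finite) tree with $|V(T)|\ge r+1$. Let $v$ be a shedding vertex of $\mathrm{Ind}_r(T)$. Then, for every connected subgraph $C$ of $T$ containing $v$ and satisfying $|V(C)|\le r-1$, the complex $\mathrm{lk}_{\mathrm{Ind}_r(T)}(V(C))$ has a shedding vertex $w$ such that the induced subgraph $T[V(C)\cup\{w\}]$ is connected.
   Context: Graphs are finite and simple. For a graph $G$ and $A\subseteq V(G)$, $G[A]$ denotes the induced subgraph on $A$. A tree is a connected graph in which there is a unique path between every pair of distinct vertices. A connected subgraph of $T$ is identified with its vertex set and the subgraph it induces. For an integer $r\ge 1$, a subset $A\subseteq V(G)$ is $r$-independent if every connected component of $G[A]$ has at most $r$ vertices. The $r$-independence complex $\mathrm{Ind}_r(G)$ is the simplicial complex whose faces are all $r$-independent subsets of $V(G)$. Facets of a simplicial complex are its inclusion-maximal faces. For a face $F$ of a simplicial complex $\Delta$, $\mathrm{lk}_\Delta(F)=\{F'\in\Delta : F\cap F'=\emptyset,\ F\cup F'\in\Delta\}$. For a vertex $w$ of $\Delta$ (i.e. $\{w\}\in\Delta$), $\mathrm{del}_\Delta(w)=\{F\in\Delta: w\notin F\}$. The vertex $w$ is a shedding vertex of $\Delta$ if every facet of $\mathrm{del}_\Delta(w)$ is a facet of $\Delta$; equivalently, for every facet $F$ of $\mathrm{del}_\Delta(w)$, $F\cup\{w\}$ is not a face of $\Delta$. *)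

(* Defs.v *)
From mathcomp Require Import all_boot.

Set Implicit Arguments.
Unset Strict Implicit.
Unset Printing Implicit Defensive.

(* A finite simple graph on [V] is a symmetric irreflexive
   relation [e : rel V]; an induced subgraph is given by its vertex set. *)

Section Graphs.
Variables (V : finType) (e : rel V).

Definition simple_graph : Prop := symmetric e /\ irreflexive e.

Definition induced (A : {set V}) : rel V :=
  [rel x y | [&& x \in A, y \in A & e x y]].

(* The empty graph is not connected. *)
Definition connected_set (A : {set V}) : bool :=
  (A != set0) && [forall x in A, forall y in A, connect (induced A) x y].

(* [x :: p] is a path from [x] to [y] without repeated vertices. *)
Definition simple_path (x y : V) (p : seq V) : bool :=
  [&& path e x p, last x p == y & uniq (x :: p)].

Definition tree : Prop :=
  [/\ simple_graph, connected_set [set: V]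
    & forall x y : V, x != y -> exists! p : seq V, simple_path x y p].

(* The component is meaningful for [x \in A]: [connect] is reflexive, so
   otherwise it is [[set x]]. *)
Definition component (A : {set V}) (x : V) : {set V} :=
  [set y | connect (induced A) x y].

Definition independent (r : nat) (A : {set V}) : bool :=
  [forall x in A, #|component A x| <= r].

Definition Ind (r : nat) : {set {set V}} := [set A | independent r A].

End Graphs.

Section Complexes.
Variables (V : finType) (D : {set {set V}}).

Definition facet (F : {set V}) : bool := maxset [pred A | A \in D] F.

Definition link (F : {set V}) : {set {set V}} :=
  [set F' in D | [disjoint F & F'] && (F :|: F' \in D)].

Definition deletion (w : V) : {set {set V}} := [set F in D | w \notin F].

End Complexes.

Definition shedding_vertex (V : finType) (D : {set {set V}}) (w : V) : Prop :=
  [set w] \in D /\ forall F : {set V}, facet (deletion D w) F -> facet D F.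

(* Main.v *)
Require Import Defs.
From mathcomp Require Import all_boot.

(* Root the tree at [v], let [D x] be the set of descendants of [x], and let
   [S] consist of [v] and of the components of [T - v] of order at most [r].
   If [v] is shedding then [|S| > r].  Hence [S] is not contained in [C]; among
   the vertices of [S] outside [C] that are adjacent to [C], choose [w] with
   [|D w|] maximal.  Suppose that [w] lies in an independent set [B] containing
   [C], and let [K] be its component in [B].  As [|K| <= r < |S|], some [y] in
   [S] outside [K] has its parent in [K]; it may be taken in [D w] if [D w] is
   not contained in [K].  Replacing [w] by [y] keeps [B] independent: the
   component of [y] lies in [D w] in one case, and in [(K - D w) + D y], with
   [|D y| <= |D w|], in the other.  So [B - w] is not maximal among the
   independent sets avoiding [w]. *)

Set Implicit Arguments.
Unset Strict Implicit.
Unset Printing Implicit Defensive.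

(** * Components and independent sets in a graph *)

Section Independence.
Variables (V : finType) (e : rel V).

Lemma connect_inducedS (A B : {set V}) (x y : V) :
  A \subset B -> connect (induced e A) x y -> connect (induced e B) x y.
Proof.
move=> /subsetP sAB; apply: connect_sub x y => x y /and3P[xA yA exy].
by apply: connect1; rewrite /induced /= !sAB.
Qed.

(** A path inside [A] that starts in [Z] cannot leave [Z]. Components are bounded below by
    exhibiting such a [Z]. *)
Lemma component_sub_closed (A Z : {set V}) (x : V) :
  x \in A -> x \in Z ->
  (forall a b, a \in A -> b \in A -> e a b -> a \in Z -> b \in Z) ->
  component e A x \subset A :&: Z.
Proof.
move=> xA xZ clZ; apply/subsetP => y; rewrite inE => /connectP[p].
elim: p x xA xZ => [|z p IHp] x xA xZ /=; first by move=> _ ->; rewrite inE xA.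
by case/andP=> /and3P[_ zA exz] pp; apply: IHp (clZ _ _ _ _ exz xZ) pp.
Qed.

Lemma component_sub (A : {set V}) (x : V) : x \in A -> component e A x \subset A.
Proof. by move=> xA; rewrite -{2}[A]setIid; apply: component_sub_closed. Qed.

Lemma component_step (A : {set V}) (x a b : V) :
  a \in A -> b \in A -> e a b -> a \in component e A x -> b \in component e A x.
Proof.
rewrite !inE => aA bA eab /connect_trans; apply; apply: connect1.
by rewrite /induced /= aA bA.
Qed.

Lemma independent_card (r : nat) (A : {set V}) : #|A| <= r -> independent e r A.
Proof.
move=> leAr; apply/forall_inP => x xA.
exact: leq_trans (subset_leq_card (component_sub xA)) leAr.
Qed.

Lemma independentS (r : nat) (A B : {set V}) :
  A \subset B -> independent e r B -> independent e r A.
Proof.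
move=> sAB /forall_inP indB; apply/forall_inP => x xA.
apply: leq_trans (indB x (subsetP sAB x xA)); apply: subset_leq_card.
by apply/subsetP => y; rewrite !inE; apply: connect_inducedS.
Qed.

(** By symmetry no edge of [B'] joins [Z] to its complement, so a component of [B'] lies either in
    [Z], which is small, or in a component of [B]. *)
Lemma independent_patch (r : nat) (B B' Z : {set V}) :
  symmetric e -> independent e r B -> #|Z| <= r -> B' \subset B :|: Z ->
  (forall a b, a \in B' -> b \in B' -> e a b -> a \in Z -> b \in Z) ->
  independent e r B'.
Proof.
move=> esym /forall_inP indB leZ /subsetP sB' clZ; apply/forall_inP => x xB'.
have inB a : a \in B' -> a \notin Z -> a \in B.
  by move=> /sB'; rewrite inE => /orP[//|->].
have [xZ|xZ] := boolP (x \in Z).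
  apply: leq_trans leZ; apply: subset_leq_card.
  by apply: subset_trans (component_sub_closed xB' xZ clZ) (subsetIr _ _).
apply: leq_trans (indB x (inB x xB' xZ)); apply: subset_leq_card.
apply: subset_trans (subset_trans (component_sub_closed
  (Z := component e B x :\: Z) xB' _ _) (subsetIr _ _)) (subsetDl _ _).
  by rewrite !inE xZ connect0.
move=> a b aB' bB' eab /setDP[aK aZ]; rewrite inE.
have bZ : b \notin Z.
  by apply: contra aZ; apply: clZ => //; rewrite esym.
by rewrite bZ; apply: component_step eab aK; apply: inB.
Qed.

Lemma connected_setU1 (C : {set V}) (w z : V) :
  symmetric e -> connected_set e C -> z \in C -> e w z ->
  connected_set e (C :|: [set w]).
Proof.
move=> esym /andP[_ /forall_inP conC] zC ewz; apply/andP; split.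
  by apply/set0Pn; exists w; rewrite !inE eqxx orbT.
have toz x : x \in C :|: [set w] ->
    connect (induced e (C :|: [set w])) x z
    /\ connect (induced e (C :|: [set w])) z x.
  rewrite inE => /orP[xC|/set1P->].
    have /forall_inP/(_ z zC) xz := conC x xC.
    have /forall_inP/(_ x xC) zx := conC z zC.
    by split; [apply: connect_inducedS xz|apply: connect_inducedS zx];
      apply: subsetUl.
  by split; apply: connect1; rewrite /induced /= !inE eqxx zC orbT //= esym.
apply/forall_inP => x xC; apply/forall_inP => y yC.
by have [xz _] := toz x xC; have [_ zy] := toz y yC; apply: connect_trans xz zy.
Qed.

End Independence.

(** * Paths to the root of a tree and descendants *)

(* [P x] lists the vertices of the path from [x] to the root [v], without [x];
   its head is thus the parent of [x]. *)
Definition root_paths (V : finType) (e : rel V) (v : V) (P : V -> seq V) : Prop :=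
  [/\ P v = [::],
      forall x, x != v -> exists2 z, P x = z :: P z & e x z
    & forall x y, e x y -> P x = y :: P y \/ P y = x :: P x].

(** Take for [P x] the simple path from [x] to [v] without its first vertex; uniqueness yields all
    three properties. *)
Lemma tree_root_paths (V : finType) (e : rel V) (v : V) :
  tree e -> exists P, root_paths e v P.
Proof.
case=> [[esym eirr] _ uniqp].
have uniqv x : exists p, simple_path e x v p /\
    forall q, simple_path e x v q -> q = p.
  (* Uniqueness in [tree] concerns distinct ends; a nonempty path from [v] to [v] would repeat
     [v]. *)
  have [->|nxv] := eqVneq x v.
    exists [::]; split=> [|q]; first by rewrite /simple_path /= eqxx.
    case/and3P; case: q => //= y q _ /eqP lq /andP[]; rewrite -{1}lq.
    by rewrite mem_last.
  have [p [pp up]] := uniqp x v nxv.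
  by exists p; split=> // q /up.
have [P PP] := fin_all_exists uniqv; exists P.
have PE x q : simple_path e x v q -> P x = q by move/(proj2 (PP x)).
split.
- by apply: PE; rewrite /simple_path /= eqxx.
- move=> x nxv; have [/and3P[]] := PP x.
  case: {PP}(P x) => [|z p] /=; first by rewrite (negPf nxv).
  case/andP=> exz pp lp /andP[_ up] _; exists z => //.
  by rewrite (PE z p) // /simple_path pp lp.
move=> x y exy; have [/and3P[py /eqP ly uy] _] := PP y.
have [xPy|xPy] := boolP (x \in P y); last first.
  left; apply: PE; rewrite /simple_path /= exy py ly eqxx /= inE negb_or xPy.
  by rewrite -cons_uniq uy !andbT; apply: contraTneq exy => ->; rewrite eirr.
(* When [x] lies on the path from [y], the shortcut through [y], [x], [p2] is also a simple path,
   hence the same one. *)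
have [p1 [p2 Ey]] : exists p1 p2, P y = p1 ++ x :: p2.
  by case/splitPr: xPy => p1 p2; exists p1, p2.
right; move: py ly uy; rewrite Ey cat_path last_cat cons_uniq cat_uniq /= -Ey.
case/andP=> _ /andP[_ p2p] lp2 /andP[yn /and3P[_ _ /andP[xp2 up2]]].
have Px : P x = p2 by apply: PE; rewrite /simple_path p2p lp2 eqxx /= xp2.
rewrite Px; apply: PE; rewrite /simple_path /= esym exy p2p lp2 eqxx /= xp2 up2.
by move: yn; rewrite Ey mem_cat => /norP[_ ->].
Qed.

Section RootedTree.
Variables (V : finType) (e : rel V) (v : V) (P : V -> seq V).
Hypotheses (esym : symmetric e) (rP : root_paths e v P).

Definition descendants (x : V) : {set V} := [set y | x \in y :: P y].
Local Notation D := descendants.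

Lemma in_descendants x y : (y \in D x) = (x \in y :: P y).
Proof. by rewrite in_set. Qed.

Lemma descendants_refl x : x \in D x.
Proof. by rewrite in_descendants mem_head. Qed.

Lemma root_descendants x : (v \in D x) = (x == v).
Proof. by have [Pv _ _] := rP; rewrite !inE Pv orbF. Qed.

Lemma root_paths_ind (Q : V -> Prop) :
  Q v -> (forall x z, P x = z :: P z -> e x z -> Q z -> Q x) -> forall x, Q x.
Proof.
have [_ Pc _] := rP; move=> Qv Qs x.
have [n] := ubnP (size (P x)); elim: n x => // n IHn x.
have [->|nxv] := eqVneq x v; first by [].
by have [z Px exz] := Pc x nxv; rewrite Px /= ltnS => /IHn; apply: Qs.
Qed.

Lemma root_path_suffix x y : y \in D x -> exists s, y :: P y = s ++ x :: P x.
Proof.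
elim/root_paths_ind: y => [|y z Py _ IHz].
  by rewrite root_descendants => /eqP->; exists [::].
rewrite in_descendants in_cons => /orP[/eqP->|]; first by exists [::].
rewrite Py => xz; have [|s Es] := IHz; first by rewrite inE.
by exists (y :: s); rewrite Es.
Qed.

Lemma descendants_sub x y : y \in D x -> D y \subset D x.
Proof.
rewrite in_descendants => xy; apply/subsetP => z /root_path_suffix[s Es].
by rewrite in_descendants Es mem_cat xy orbT.
Qed.

(** Every edge joins a vertex to its parent, and a child of a descendant is a descendant, so [D x]
    can be left only from [x]. *)
Lemma descendants_cut x y z :
  y \in D x -> z \notin D x -> e y z -> y = x /\ P x = z :: P z.
Proof.
have [_ _ Pe] := rP; rewrite !in_descendants => xy xz /Pe[Py|Pz].
  by move: xy; rewrite Py in_cons (negPf xz) orbF => /eqP->.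
by case/negP: xz; rewrite Pz in_cons xy orbT.
Qed.

Lemma descendants_child x y z : P y = z :: P z -> z \in D x -> y \in D x.
Proof. by rewrite !in_descendants => -> zx; rewrite in_cons zx orbT. Qed.

(** Climb from [x] towards the root: [z] is the first vertex met in [A], and [y] the one before
    it. *)
Lemma exists_exit (A : {set V}) (x : V) : v \in A -> x \notin A ->
  exists y z, [/\ x \in D y, y \notin A, z \in A, P y = z :: P z & e y z].
Proof.
move=> vA; elim/root_paths_ind: x => [|x z Px exz IHz xA]; first by rewrite vA.
have [zA|zA] := boolP (z \in A).
  by exists x, z; rewrite descendants_refl.
have [y [t [zy yA tA Py eyt]]] := IHz zA; exists y, t; split=> //.
exact: descendants_child zy.
Qed.

Lemma exists_exit_descendants (A : {set V}) (x y0 : V) :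
  x != v -> x \in A -> y0 \in D x -> y0 \notin A ->
  exists y z, [/\ y \in D x, y \notin A, z \in A :&: D x & e y z].
Proof.
move=> nxv xA y0x y0A.
(* Adding the complement of [D x] puts the root into the set and keeps the exit vertex [y] inside
   [D x]. *)
have [||y [z [_ yA zA Py eyz]]] := exists_exit (A := A :|: ~: D x) (x := y0).
- by rewrite in_setU in_setC root_descendants nxv orbT.
- by rewrite in_setU in_setC y0x orbF.
move: yA; rewrite in_setU in_setC negb_or negbK => /andP[yA yx].
exists y, z; split=> //; move: zA; rewrite in_setU in_setC in_setI.
have [zx|zx _] := boolP (z \in D x); first by rewrite orbF andbT.
by have [yE _] := descendants_cut yx zx eyz; rewrite yE xA in yA.
Qed.

(** The set grows from [x] by one exit vertex at a time. For [k = r] its order is the least that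
    independence forbids. *)
Lemma connected_subset_descendants (x : V) (k : nat) :
  x != v -> k < #|D x| ->
  exists A : {set V}, [/\ x \in A, A \subset D x, #|A| = k.+1
    & forall y, y \in A -> connect (induced e A) x y].
Proof.
move=> nxv; elim: k => [|k IHk] ltk.
  exists [set x]; rewrite set11 cards1 sub1set descendants_refl; split=> //.
  by move=> y /set1P->.
have [A [xA sAD cA conA]] := IHk (ltnW ltk).
have /subsetPn[y0 y0x y0A] : ~~ (D x \subset A).
  by apply: contraL ltk => /subset_leq_card; rewrite cA -leqNgt.
have [y [z [yx yA /setIP[zA zx] eyz]]] := exists_exit_descendants nxv xA y0x y0A.
have sub : A \subset y |: A by apply: subsetUr.
exists (y |: A); rewrite !inE xA orbT; split=> //.
- by rewrite subUset sub1set yx.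
- by rewrite cardsU1 yA cA.
move=> t /setU1P[->|tA]; last by apply: connect_inducedS sub (conA t tA).
apply: connect_trans (connect_inducedS sub (conA z zA)) (connect1 _).
by rewrite /induced /= !inE zA eqxx orbT /= esym.
Qed.

(** Read from the root, the path of [z] starts with [v], [x0] and also with [v], [x1]. *)
Lemma root_child_unique x0 x1 z :
  P x0 = [:: v] -> P x1 = [:: v] -> z \in D x0 -> z \in D x1 -> x0 = x1.
Proof.
move=> P0 P1 /root_path_suffix[s Es] /root_path_suffix[t].
by rewrite Es P0 P1 => /(congr1 rev); rewrite !rev_cat => -[].
Qed.

(** * Small branches and the shedding hypothesis *)

(* Equivalently, [v] together with the components of [T - v] of order at most
   [r]. *)
Definition small_branches (r : nat) : {set V} :=
  [set y | [forall x, (x != v) && (y \in D x) ==> (#|D x| <= r)]].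
Local Notation S := small_branches.

Lemma small_branchesP r y :
  reflect (forall x, x != v -> y \in D x -> #|D x| <= r) (y \in S r).
Proof.
rewrite inE; apply: (iffP forallP) => [H x xv yx|H x].
  by have /implyP := H x; apply; rewrite xv.
by apply/implyP => /andP[]; apply: H.
Qed.

Lemma root_small_branches r : v \in S r.
Proof. by apply/small_branchesP => x /negPf nxv; rewrite root_descendants nxv. Qed.

Lemma small_branches_ancestor r x y : y \in D x -> y \in S r -> x \in S r.
Proof.
move=> yx /small_branchesP yS; apply/small_branchesP => t tv xt.
by apply: yS => //; apply: subsetP (descendants_sub xt) _ yx.
Qed.

(** Ancestors of small vertices are small, so [y] is the parent of [z] and [D z] itself must be
    large; for [y != v] it would lie in the small set [D y]. *)
Lemma small_branches_cut r y z : y \in S r -> z \notin S r -> e y z ->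
  [/\ y = v, P z = [:: v] & r < #|D z|].
Proof.
have [Pv _ Pe] := rP; move=> yS zS /Pe[Py|Pz].
  case/negP: zS; apply: small_branches_ancestor yS.
  by rewrite in_descendants Py !inE eqxx orbT.
have bigz : r < #|D z|.
  rewrite ltnNge; apply: contra zS => lez; apply/small_branchesP => x xv.
  rewrite in_descendants Pz in_cons => /orP[/eqP->//|xy].
  by move/small_branchesP: yS; apply; rewrite // in_descendants.
have [yv|nyv] := eqVneq y v; first by rewrite Pz yv Pv.
move/small_branchesP/(_ y nyv (descendants_refl y)): yS; rewrite leqNgt.
case/negP; apply: leq_trans bigz _; apply: subset_leq_card.
by apply: descendants_sub; apply: descendants_child Pz (descendants_refl y).
Qed.

(* Otherwise take in every large branch, with top [x], a connected set of
   order [r.+1] containing [x], and remove [x]: in any facet of the deletion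
   extending these sets and the small branches no top [x] occurs, so [v] can be
   added without creating a large component. *)
Lemma shedding_small_branches r :
  shedding_vertex (Ind e r) v -> r < #|S r|.
Proof.
case=> _ shed; rewrite ltnNge; apply/negP => leS.
(* The choice must be total; [set0] is a dummy value where the hypotheses on [x] fail. *)
have /fin_all_exists[A HA] x : exists A : {set V}, P x = [:: v] -> r < #|D x| ->
    [/\ x \in A, A \subset D x, #|A| = r.+1
      & forall y, y \in A -> connect (induced e A) x y].
  have [->|nxv] := eqVneq x v; first by have [-> _ _] := rP; exists set0.
  have [big|] := ltnP r #|D x|; last by exists set0.
  by have [A HA] := connected_subset_descendants nxv big; exists A.
pose L := [set x | (P x == [:: v]) && (r < #|D x|)].
have LP x : x \in L -> P x = [:: v] /\ r < #|D x|.
  by rewrite inE => /andP[/eqP].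
have Lv x : x \in L -> x != v.
  move=> /LP[Px _]; apply/eqP => xv; move: Px.
  by have [Pv _ _] := rP; rewrite xv Pv.
have cutL y z : y \in S r -> z \notin S r -> e y z -> z \in L /\ y = v.
  move=> yS zS eyz; have [-> Pz big] := small_branches_cut yS zS eyz.
  by rewrite inE Pz eqxx.
pose B := \bigcup_(x in L) (A x :\ x).
pose B0 := (S r :\ v) :|: B.
have nvB0 : v \notin B0.
  rewrite !inE eqxx /=; apply/bigcupP => -[x xL] /setD1P[_ vA].
  have [Px big] := LP x xL; have [_ /subsetP/(_ v vA) + _ _] := HA x Px big.
  by rewrite root_descendants; apply/negP/Lv.
have indB : independent e r B.
  apply/forall_inP => x xB; have /bigcupP[x0 x0L xA] := xB.
  have [P0 big0] := LP x0 x0L; have [x0A sA cA _] := HA x0 P0 big0.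
  have -> : r = #|A x0 :\ x0| by move: cA; rewrite (cardsD1 x0) x0A => -[].
  apply: subset_leq_card.
  apply: subset_trans (component_sub_closed xB xA _) (subsetIr _ _).
  (* The only exit from [D x0] is [x0], which has been removed, so [b] lies in the same branch as
     [a]. *)
  move=> a b _ /bigcupP[x1 x1L bA1] eab /setD1P[ax0 aA].
  have [P1 big1] := LP x1 x1L; have [_ sA1 _ _] := HA x1 P1 big1.
  have b1 : b \in D x1 by apply: (subsetP sA1); case/setD1P: bA1.
  have b0 : b \in D x0.
    apply: contraR ax0 => b0.
    by have [->] := descendants_cut (subsetP sA _ aA) b0 eab.
  by rewrite (root_child_unique P0 P1 b0 b1).
have indB0 : independent e r B0.
  (* Without [v], no edge joins the small branches to the large ones. *)
  apply: (independent_patch esym indB leS).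
    by rewrite [B :|: _]setUC; apply: setSU; apply: subsetDl.
  move=> a b aB bB eab aS; apply: contraT => bS.
  by have [_ av] := cutL a b aS bS eab; rewrite av (negPf nvB0) in aB.
have [F maxF sB0F] : {F | facet (deletion (Ind e r) v) F & B0 \subset F}.
  by apply: maxset_exists; rewrite /= inE nvB0 inE indB0.
have /maxsetP[/= FI Fmax] := shed F maxF.
have /maxsetP[/= + _] := maxF; rewrite inE => /andP[_ nvF].
have indF : independent e r F by rewrite inE in FI.
(* A top [x] in [F] would complete [A x], a connected set of order [r.+1], inside [F]. *)
have LF x : x \in L -> x \notin F.
  move=> xL; apply/negP => xF; have [Px big] := LP x xL.
  have [xA _ cA conA] := HA x Px big.
  have sAF : A x \subset F.
    apply/subsetP => y yA; have [->//|nyx] := eqVneq y x.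
    apply: (subsetP sB0F); rewrite inE; apply/orP; right.
    by apply/bigcupP; exists x => //; rewrite !inE nyx.
  have := forall_inP indF x xF; rewrite leqNgt -cA => /negP; apply.
  apply: subset_leq_card; apply/subsetP => y /conA.
  by rewrite inE; apply: connect_inducedS.
suff indFv : independent e r (v |: F).
  by case/negP: nvF; rewrite -(Fmax (v |: F)) ?setU11 ?subsetUr //= inE.
apply: (independent_patch esym indF leS).
  by rewrite setUC; apply: setUS; rewrite sub1set root_small_branches.
move=> a b _ /setU1P[-> _ _|bF eab aS]; first exact: root_small_branches.
apply: contraT => bS; have [bL _] := cutL a b aS bS eab.
by rewrite (negPf (LF b bL)) in bF.
Qed.

(** * Exchanging a vertex of an independent set *)

Lemma independent_exchange r (B : {set V}) (w : V) :
  independent e r B -> w != v -> w \in S r -> w \in B -> r < #|S r| ->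
  v \in component e B w ->
  (forall y, y \in S r -> y \notin component e B w -> #|D y| <= #|D w|) ->
  exists2 y, y \notin B & independent e r (y |: B :\ w).
Proof.
move=> indB nwv wS wB bigS vK maxw.
pose K := component e B w; rewrite -/K in vK maxw.
have sKB : K \subset B by apply: component_sub.
have wK : w \in K by rewrite inE connect0.
have exitB y z : y \notin K -> z \in K -> e y z -> y \notin B.
  move=> yK zK eyz; apply: contra yK => yB.
  by apply: component_step (subsetP sKB _ zK) yB _ zK; rewrite esym.
have leD : #|D w| <= r.
  by apply: (small_branchesP _ _ wS) => //; apply: descendants_refl.
have cut_w a b : a \in D w -> b \notin D w -> e a b -> a = w.
  by move=> aw bw eab; have [] := descendants_cut aw bw eab.
(* If [K] misses part of [D w], take [y] there, adjacent to [K]: once [w] is removed nothing leaves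
   [D w], which has at most [r] vertices. *)
have [sDK|/subsetPn[y0 y0w y0K]] := boolP (D w \subset K); last first.
  have [y [z [yw yK /setIP[zK zw] eyz]]] := exists_exit_descendants nwv wK y0w y0K.
  have nyw : w != y by apply: contraNneq yK => <-.
  exists y; first exact: exitB yK zK eyz.
  apply: (independent_patch esym indB leD).
    rewrite subUset sub1set inE yw orbT /=.
    by apply: subset_trans (subsetUl _ _); apply: subsetDl.
  move=> a b aB _ eab aw; apply: contraT => bw.
  by move: aB; rewrite (cut_w a b aw bw eab) !inE eqxx (negPf nyw).
have leK : #|K| <= r by apply: (forall_inP indB).
have /subsetPn[y0 y0S y0K] : ~~ (S r \subset K).
  by apply: contraL bigS => /subset_leq_card sSK; rewrite -leqNgt (leq_trans sSK).
have [y [z [y0y yK zK Py eyz]]] := exists_exit vK y0K.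
have yS := small_branches_ancestor y0y y0S.
have yw : y \notin D w by apply: contra yK; apply: (subsetP sDK).
have zw : z \notin D w by apply: contra yw; apply: descendants_child.
have yB := exitB y z yK zK eyz.
have yy := descendants_refl y.
(* [Z] trades [D w], contained in [K], for [D y], no larger by [maxw]; hence [Z] has at most [#|K|]
   vertices. The edge leaving [D y] ends at [z], still in [Z]. *)
exists y => //; apply: (independent_patch (Z := (K :\: D w) :|: D y) esym indB).
- apply: leq_trans leK; apply: leq_trans (leq_card_setU _ _) _.
  rewrite cardsD (setIidPr sDK) -(subnK (subset_leq_card sDK)) leq_add //.
    by rewrite addnK.
  exact: maxw.
- rewrite subUset sub1set in_setU (in_setU y (K :\: _)) yy !orbT /=.
  by apply: subset_trans (subsetUl _ _); apply: subsetDl.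
move=> a b aB bB eab /setUP[/setDP[aK aw]|ay]; last first.
  have [by_|nby] := boolP (b \in D y); first by rewrite in_setU by_ orbT.
  have [_] := descendants_cut ay nby eab; rewrite Py => -[<- _].
  by rewrite in_setU in_setD zK zw.
move/setU1P: bB => [->|/setD1P[bnw bB]]; first by rewrite in_setU yy orbT.
have bK : b \in K by apply: component_step (subsetP sKB _ aK) bB eab aK.
rewrite in_setU in_setD bK andbT; apply/orP; left.
by apply: contra bnw => bw; rewrite (cut_w b a bw aw) // esym.
Qed.

End RootedTree.

(** * The shedding vertex of the link *)

Theorem lemma3p3 (r : nat) (V : finType) (e : rel V) (v : V) :
  1 <= r ->
  tree e ->
  r + 1 <= #|V| ->
  shedding_vertex (Ind e r) v ->
  forall C : {set V},
    connected_set e C -> v \in C -> #|C| <= r - 1 ->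
    exists w : V,
      shedding_vertex (link (Ind e r) C) w /\ connected_set e (C :|: [set w]).
Proof.
move=> r1 treeT _ shed C conC vC leC.
have [[esym _] _ _] := treeT.
have [P rP] := tree_root_paths v treeT.
have bigS := shedding_small_branches esym rP shed.
(* This strict bound leaves room for [w]: a set [C] plus one vertex is still a face. *)
have ltC : #|C| < r by rewrite -(subnK r1) addn1 ltnS.
pose S := small_branches v P r; pose D := descendants P.
pose N := [pred y | [&& y \in S, y \notin C & [exists z in C, e y z]]].
(* Every small vertex outside [C] descends from a candidate, so the maximal [#|D w|] bounds [#|D y|]
   for all of them. *)
have inN x : x \in S -> x \notin C -> exists2 y, N y & x \in D y.
  move=> xS xC; have [y [z [xy yC zC Py eyz]]] := exists_exit rP vC xC.
  exists y => //; rewrite /N /= yC (small_branches_ancestor rP xy xS) /=.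
  by apply/exists_inP; exists z.
have /subsetPn[x0 x0S x0C] : ~~ (S \subset C).
  apply: contraL bigS => /subset_leq_card sSC.
  by rewrite -leqNgt (leq_trans sSC) // ltnW.
have [w0 Nw0 _] := inN x0 x0S x0C.
have [w /and3P[wS wC /exists_inP[z zC ewz]] maxw] :=
  arg_maxnP (fun y => #|D y|) Nw0.
have nwv : w != v by apply: contraNneq wC => ->.
have conCw := connected_setU1 esym conC zC ewz.
exists w; split=> //; split.
  rewrite !inE !independent_card ?cards1 //=; last first.
    by rewrite setUC cardsU1 wC.
  by rewrite disjoint_sym disjoints1 wC.
move=> F /maxsetP[/= FD Fmax]; apply/maxsetP => /=.
have /setIdP[/setIdP[FI /andP[dCF CFI]] wF] := FD.
split=> [|F' F'L sFF']; first by case/setIdP: FD.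
(* If [F'] avoids [w], maximality of [F] in the deletion applies directly; otherwise the exchange
   contradicts it. *)
have [wF'|wF'] := boolP (w \in F'); last by apply: Fmax => //=; apply/setIdP.
pose B := w |: (C :|: F).
have /setIdP[_ /andP[_]] := F'L; rewrite inE => CF'I.
have indB : independent e r B.
  by apply: independentS CF'I; rewrite !subUset sub1set !inE wF' orbT subsetUl
    subsetU // sFF' orbT.
(* Thus the root lies in the component of [w], and vertices outside that component are outside
   [C]. *)
have CK : C \subset component e B w.
  apply/subsetP => c cC; rewrite inE.
  have /andP[_ /forall_inP/(_ w)] := conCw; rewrite !inE eqxx orbT.
  move=> /(_ isT) /forall_inP/(_ c); rewrite !inE cC => /(_ isT).
  by apply: connect_inducedS; rewrite setUC setUS // subsetUl.
have [||y yB indy] := independent_exchange esym rP indB nwv wS (setU11 _ _) bigS.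
- exact: subsetP vC.
- move=> y yS yK; have yC : y \notin C by apply: contra yK; apply: subsetP.
  have [w' Nw' yw'] := inN y yS yC; apply: leq_trans (maxw _ Nw').
  by apply: subset_leq_card; apply: (descendants_sub rP).
have BE : B :\ w = C :|: F by rewrite /B setU1K // inE negb_or wC wF.
rewrite BE in indy.
move: yB; rewrite !inE !negb_or => /and3P[nyw yC yF].
case/negP: (yF); rewrite -(Fmax (y |: F)) ?setU11 ?subsetUr //=.
rewrite !inE negb_or eq_sym nyw wF andbT -setI_eq0 setIUr.
have -> : C :|: (y |: F) = y |: (C :|: F) by rewrite setUCA.
rewrite indy andbT; apply/andP; split.
  by apply: independentS indy; apply: setUS; apply: subsetUr.
by rewrite setU_eq0 !setI_eq0 dCF disjoint_sym disjoints1 yC.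
Qed.
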